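(* Let $X$ be a real Hilbert space and let $A\colon X\rightrightarrows X$ be maximally monotone, with reflected resolvent $R_A$. Consider the following statements: (i) $A$ is uniformly monotone. (ii) $-R_A$ is super strongly nonexpansive. (iii) $-R_A$ is strongly nonexpansive. Then (i) $\Leftrightarrow$ (ii) $\Rightarrow$ (iii).
   Context: For $A\colon X\rightrightarrows X$, $\operatorname{gra}A=\{(x,x^* )\in X\times X : x^*\in Ax\}$. The resolvent of $A$ is $J_A=(\mathrm{Id}+A)^{-1}$ and the reflected resolvent is $R_A=2J_A-\mathrm{Id}$; for maximally monotone $A$ these are single-valued and defined on all of $X$. A modulus is an increasing (nondecreasing) function $\phi\colon[0,\infty)\to[0,+\infty]$ that vanishes only at $0$. $A$ is uniformly monotone if there is a modulus $\phi$ such that $\langle x-y,x^*-y^*\rangle\ge\phi(\|x-y\|)$ for all $(x,x^* ),(y,y^* )\in\operatorname{gra}A$. $T\colon X\to X$ is nonexpansive if $\|Tx-Ty\|\le\|x-y\|$ for all $x,y\in X$. $T$ is strongly nonexpansive if it is nonexpansive and, for all sequences $(x_n),(y_n)$ in $X$, if $(x_n-y_n)$ is bounded and $\|x_n-y_n\|-\|Tx_n-Ty_n\|\to0$, then $(x_n-y_n)-(Tx_n-Ty_n)\to0$. $T$ is super strongly nonexpansive if it is nonexpansive and, for all sequences $(x_n),(y_n)$ in $X$, $\|x_n-y_n\|^2-\|Tx_n-Ty_n\|^2\to0$ implies $(x_n-y_n)-(Tx_n-Ty_n)\to0$. *)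

(* Defs.v *)
From mathcomp Require Import all_boot all_order all_algebra.
From mathcomp Require Import all_classical all_reals all_analysis.
Set Implicit Arguments.
Unset Strict Implicit.
Unset Printing Implicit Defensive.

Import Order.TTheory GRing.Theory Num.Theory.
Import numFieldNormedType.Exports.

Local Open Scope classical_set_scope.
Local Open Scope ring_scope.

(* A real Hilbert space is a complete normed module X over R together with a
   positive definite symmetric form whose square root is the norm of X. *)
Definition hilbert_form (R : realType) (X : completeNormedModType R)
    (dot : {dot X for (@idfun R)}) : Prop :=
  forall x : X, dot x x = `|x| ^+ 2.

Section Operators.
Context {R : realType} {X : completeNormedModType R}.

(* Set-valued operators on X are functions X -> set X. *)
Definition gra (A : X -> set X) : set (X * X) := [set p | A p.1 p.2].

Definition op_inverse (A : X -> set X) : X -> set X :=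
  fun y => [set x | A x y].

Definition id_plus (A : X -> set X) : X -> set X :=
  fun x => [set x + u | u in A x].

Definition resolvent (A : X -> set X) : X -> set X := op_inverse (id_plus A).

(* By Minty's theorem, for maximally monotone A, resolvent A x is a singleton
   for every x, and resolvent_fun A x is its element.  When resolvent A x is
   empty, the value is an arbitrary default. *)
Definition resolvent_fun (A : X -> set X) : X -> X :=
  fun x => get (resolvent A x).

Definition reflected_resolvent (A : X -> set X) : X -> X :=
  fun x => 2 *: resolvent_fun A x - x.

Definition monotone_op (dot : X -> X -> R) (A : X -> set X) : Prop :=
  forall p q, gra A p -> gra A q -> 0 <= dot (p.1 - q.1) (p.2 - q.2).

Definition maximally_monotone (dot : X -> X -> R) (A : X -> set X) : Prop :=
  monotone_op dot A /\
  forall B : X -> set X,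
    monotone_op dot B -> gra A `<=` gra B -> gra B = gra A.

(* Only the restriction of phi to [0, +oo[ is constrained. *)
Definition modulus (phi : R -> \bar R) : Prop :=
  [/\ forall t : R, 0 <= t -> (0 <= phi t)%E,
      forall s t : R, 0 <= s -> s <= t -> (phi s <= phi t)%E
    & forall t : R, 0 <= t -> (phi t = 0%E <-> t = 0)].

Definition uniformly_monotone (dot : X -> X -> R) (A : X -> set X) : Prop :=
  exists2 phi : R -> \bar R, modulus phi &
    forall p q, gra A p -> gra A q ->
      (phi `|p.1 - q.1|%R <= (dot (p.1 - q.1)%R (p.2 - q.2)%R)%:E)%E.

Definition nonexpansive (T : X -> X) : Prop :=
  forall x y, `|T x - T y| <= `|x - y|.

Definition strongly_nonexpansive (T : X -> X) : Prop :=
  nonexpansive T /\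
  forall x y : nat -> X,
    bounded_fun (fun n => x n - y n) ->
    `|x n - y n| - `|T (x n) - T (y n)| @[n --> \oo] --> (0 : R) ->
    (x n - y n) - (T (x n) - T (y n)) @[n --> \oo] --> (0 : X).

Definition super_strongly_nonexpansive (T : X -> X) : Prop :=
  nonexpansive T /\
  forall x y : nat -> X,
    `|x n - y n| ^+ 2 - `|T (x n) - T (y n)| ^+ 2 @[n --> \oo] --> (0 : R) ->
    (x n - y n) - (T (x n) - T (y n)) @[n --> \oo] --> (0 : X).

End Operators.

(* Main.v *)
Require Import Defs.
From mathcomp Require Import all_boot all_order all_algebra.
From mathcomp Require Import all_classical all_reals all_analysis.
From mathcomp Require Import ring lra.
Import Order.TTheory GRing.Theory Num.Theory.
Import numFieldNormedType.Exports.
Local Open Scope classical_set_scope.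
Local Open Scope ring_scope.

(* With T = - R_A, p = J_A x and q = J_A y one has
   (x - y) - (Tx - Ty) = 2 (p - q) and
   |x - y|^2 - |Tx - Ty|^2 = 4 <p - q, (x - p) - (y - q)>,
   and the pairs (p, x - p) are exactly the graph of A.  So T is super strongly
   nonexpansive iff <p_n - q_n, u_n - v_n> -> 0 forces p_n - q_n -> 0 along
   the graph, i.e. iff t |-> inf { <p - q, u - v> : |p - q| >= t } is a modulus.
   That J_A is everywhere defined (Minty) is obtained by minimizing the
   Fitzpatrick function plus half the squared norm: strong convexity makes
   minimizing sequences Cauchy, and the first-order condition at the minimizer
   (x, u) says that (-u, -x) is monotonically related to A and x + u = 0. *)

Section HilbertForm.
Context {R : realType} {X : completeNormedModType R}.
Variables (dot : {dot X for (@idfun R)}) (dot_hilbert : hilbert_form dot).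

Let dotDl x y z : dot (x + y) z = dot x z + dot y z.
Proof. by rewrite linearDl. Qed.

Let dotDr x y z : dot x (y + z) = dot x y + dot x z.
Proof. by rewrite linearDr. Qed.

Let dotNl x y : dot (- x) y = - dot x y.
Proof. by rewrite linearNl. Qed.

Let dotNr x y : dot x (- y) = - dot x y.
Proof. by rewrite linearNr. Qed.

Let dotZl k x y : dot (k *: x) y = k * dot x y.
Proof. by rewrite linearZl_LR. Qed.

Let dotZr k x y : dot x (k *: y) = k * dot x y.
Proof. by rewrite linearZr_LR. Qed.

Let dot0r x : dot x 0 = 0.
Proof. by rewrite linear0r. Qed.

Let dotE := (dotDl, dotDr, dotNl, dotNr, dotZl, dotZr).

Lemma dotC x y : dot x y = dot y x.
Proof. by rewrite hermC expr0 mul1r. Qed.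

Lemma normD_sqr (x y : X) : `|x + y| ^+ 2 = `|x| ^+ 2 + 2 * dot x y + `|y| ^+ 2.
Proof. by rewrite -!dot_hilbert !dotE (dotC y x); ring. Qed.

Lemma normB_sqr (x y : X) : `|x - y| ^+ 2 = `|x| ^+ 2 - 2 * dot x y + `|y| ^+ 2.
Proof. by rewrite normD_sqr dotNr normrN mulrN. Qed.

Lemma norm_convex_sqr (t : R) (x y : X) :
  `|(1 - t) *: x + t *: y| ^+ 2 =
  (1 - t) * `|x| ^+ 2 + t * `|y| ^+ 2 - t * (1 - t) * `|x - y| ^+ 2.
Proof. by rewrite -!dot_hilbert !dotE (dotC y x); ring. Qed.

(** Strong convexity yields this bound for a minimizing sequence with errors [harmonic n]. *)
Lemma cvg_sqr_dist_harmonic (x : nat -> X) :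
  (forall n k, `|x n - x k| ^+ 2 <= 2 * (harmonic n + harmonic k)) ->
  cvg (x n @[n --> \oo]).
Proof.
move=> dist_x; apply/cauchy_cvgP/cauchy_exP => e e_gt0.
have e2_gt0 : 0 < e ^+ 2 / 4 by rewrite divr_gt0 ?exprn_gt0.
have [N _ small] : \forall n \near \oo, harmonic n < e ^+ 2 / 4.
  exact: (cvgr_lt _ (@cvg_harmonic R)).
exists (x N), N => // n /= Nn.
rewrite -ball_normE /ball_ /= -(ltr_pXn2r (ltn0Sn 1)) ?nnegrE ?(ltW e_gt0)//.
apply: le_lt_trans (dist_x N n) _.
have hN : harmonic N < e ^+ 2 / 4 := small N (leqnn N).
have hn : harmonic n < e ^+ 2 / 4 := small n Nn.
rewrite -/(harmonic N) -/(harmonic n); move: hN hn.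
by set a := harmonic N; set b := harmonic n; lra.
Qed.

(** * Minty's theorem by minimization of the Fitzpatrick function *)

Section Minty.
Variable A : X -> set X.
Hypothesis monoA : forall x u y v, A x u -> A y v -> 0 <= dot (x - y) (u - v).
Hypothesis maxA :
  forall x u, (forall y v, A y v -> 0 <= dot (x - y) (u - v)) -> A x u.

(* The least such [r] is [2 F(x, u) + |x|^2 + |u|^2], where [F] is the
   Fitzpatrick function of [A]: by polarization,
   [2 (<x, v> + <y, u> - <y, v>) + |x|^2 + |u|^2
    = |x + v|^2 + |y + u|^2 - |y + v|^2]. *)
Definition fitzpatrick_le (r : R) (x u : X) :=
  forall y v, A y v -> `|x + v| ^+ 2 + `|y + u| ^+ 2 <= r + `|y + v| ^+ 2.

(** Monotonicity bounds F(y, v) by <y, v> on the graph, and 2 <y, v> + |y|^2 + |v|^2 = |y + v|^2. *)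
Lemma fitzpatrick_le_gra {y v} : A y v -> fitzpatrick_le (`|y + v| ^+ 2) y v.
Proof.
move=> Ayv z w Azw; have := monoA _ _ _ _ Ayv Azw.
by rewrite !normD_sqr !dotE (dotC z v); lra.
Qed.

(** If r < |x + u|^2, the bound makes (x, u) monotonically related to A, hence a point of the graph;
    the bound at that very point is then contradictory. *)
Lemma fitzpatrick_le_lower {r x u} : fitzpatrick_le r x u -> `|x + u| ^+ 2 <= r.
Proof.
move=> le_r; rewrite leNgt; apply/negP => lt_r.
have Axu : A x u.
  apply: maxA => y v Ayv; have := le_r y v Ayv; move: lt_r.
  by rewrite !normD_sqr !dotE; lra.
by have := le_r x u Axu; move: lt_r; lra.
Qed.

(** For a fixed point of the graph, the left-hand side is a sum of squared norms of affine
    functions, to which [norm_convex_sqr] applies; the quadratic gain does not depend on that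
    point. *)
Lemma fitzpatrick_le_convex {t r s x u y v} : 0 <= t <= 1 ->
  fitzpatrick_le r x u -> fitzpatrick_le s y v ->
  fitzpatrick_le ((1 - t) * r + t * s
                  - t * (1 - t) * (`|x - y| ^+ 2 + `|u - v| ^+ 2))
    ((1 - t) *: x + t *: y) ((1 - t) *: u + t *: v).
Proof.
case/andP=> t_ge0 t_le1 le_r le_s z w Azw.
have combE (a b c : X) :
    (1 - t) *: a + t *: b + c = (1 - t) *: (a + c) + t *: (b + c).
  by rewrite !scalerDr addrACA -[in RHS]scalerDl subrK scale1r.
rewrite (addrC z) !combE !norm_convex_sqr.
have subK (a b c : X) : a + c - (b + c) = a - b by rewrite [b + c]addrC addrKA.
rewrite !subK.
have t1_ge0 : 0 <= 1 - t by rewrite subr_ge0.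
have := ler_wpM2l t1_ge0 (le_r z w Azw); have := ler_wpM2l t_ge0 (le_s z w Azw).
by rewrite (addrC z u) (addrC z v); lra.
Qed.

Lemma fitzpatrick_min : (exists y v, A y v) -> exists m x u,
  fitzpatrick_le m x u /\
  forall r y v, fitzpatrick_le r y v -> m <= r.
Proof.
move=> [y0 [v0 Ayv0]].
pose S := [set r | exists x u, fitzpatrick_le r x u].
have S_inf : has_inf S.
  split; first by exists (`|y0 + v0| ^+ 2), y0, v0; exact: fitzpatrick_le_gra.
  exists 0 => r [x [u /fitzpatrick_le_lower]].
  by apply: le_trans; rewrite exprn_ge0.
pose m := inf S.
have min_m r y v : fitzpatrick_le r y v -> m <= r.
  by move=> le_r; apply: ge_inf; [case: S_inf | exists y, v].
have approx n : exists p : X * X, fitzpatrick_le (m + harmonic n) p.1 p.2.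
  have [|r [x [u le_r]] lt_r] := @inf_adherent _ S (harmonic n) _ S_inf.
    by rewrite harmonic_gt0.
  exists (x, u) => y v Ayv; apply: le_trans (le_r y v Ayv) _.
  by rewrite lerD2r ltW.
have [z z_le] := choice approx.
have dist_z n k : `|(z n).1 - (z k).1| ^+ 2 + `|(z n).2 - (z k).2| ^+ 2 <=
    2 * (harmonic n + harmonic k).
  (* At the midpoint, minimality reads m <= m + (a + b) / 2 - d / 4, with a, b the two errors and d
     the left-hand side; hence the factor 2. *)
  have half01 : 0 <= (2^-1 : R) <= 1 by apply/andP; split; lra.
  have := min_m _ _ _ (fitzpatrick_le_convex half01 (z_le n) (z_le k)).
  by set a := harmonic n; set b := harmonic k; lra.
have /cvg_ex[/= x cvg_x] : cvg ((z n).1 @[n --> \oo]).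
  apply: cvg_sqr_dist_harmonic => n k; apply: le_trans (dist_z n k).
  by rewrite lerDl exprn_ge0.
have /cvg_ex[/= u cvg_u] : cvg ((z n).2 @[n --> \oo]).
  apply: cvg_sqr_dist_harmonic => n k; apply: le_trans (dist_z n k).
  by rewrite lerDr exprn_ge0.
exists m, x, u; split=> // y v Ayv.
have cvg_lhs : `|(z n).1 + v| ^+ 2 + `|y + (z n).2| ^+ 2 - harmonic n
    @[n --> \oo] --> `|x + v| ^+ 2 + `|y + u| ^+ 2 - 0.
  apply: cvgB (@cvg_harmonic R); apply: cvgD; rewrite expr2.
    by apply: cvgM; apply: cvg_norm; apply: cvgD => //; exact: cvg_cst.
  by apply: cvgM; apply: cvg_norm; apply: cvgD => //; exact: cvg_cst.
rewrite -[leLHS]subr0; apply: (cvgr_to_le cvg_lhs); apply: nearW => n.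
by have := z_le n y v Ayv; lra.
Qed.

Lemma minty0 : exists p, A p (- p).
Proof.
have [A_neq0|A_eq0] := pselect (exists y v, A y v); last first.
  by exists 0; apply: maxA => y v Ayv; case: A_eq0; exists y, v.
have [m [x [u [le_m min_m]]]] := fitzpatrick_min A_neq0.
(* Minimality along the segment from [(x, u)] to [(y, v)], as [t -> 0]. *)
have dist_le y v : A y v -> `|x - y| ^+ 2 + `|u - v| ^+ 2 <= `|y + v| ^+ 2 - m.
  move=> Ayv; set D := _ + _; set C := _ - _.
  have le_t t : 0 < t -> t <= 1 -> (1 - t) * D <= C.
    move=> t_gt0 t_le1; have t01 : 0 <= t <= 1 by rewrite ltW.
    have le_yv := fitzpatrick_le_gra Ayv.
    have := min_m _ _ _ (fitzpatrick_le_convex t01 le_m le_yv).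
    by rewrite -/D => m_le; rewrite -(ler_pM2l t_gt0) /C; lra.
  rewrite leNgt; apply/negP => C_lt_D.
  have C_ge0 : 0 <= C.
    by have := le_t 1 ltr01 (lexx 1); rewrite subrr mul0r.
  have D_gt0 : 0 < D := le_lt_trans C_ge0 C_lt_D.
  (* This t lies in ]0, 1] and gives (1 - t) D = (D + C) / 2 > C. *)
  have := le_t ((D - C) / (2 * D)).
  rewrite divr_gt0 ?subr_gt0 ?mulr_gt0// ler_pdivrMr ?mulr_gt0//.
  have -> : (1 - (D - C) / (2 * D)) * D = (D + C) / 2.
    by field; rewrite gt_eqF.
  by move=> /(_ isT); lra.
have le_dot y v : A y v -> `|x + u| ^+ 2 <= dot (- u - y) (- x - v).
  move=> Ayv; have := dist_le y v Ayv; have := fitzpatrick_le_lower le_m.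
  by rewrite !normB_sqr !normD_sqr !dotE (dotC u x) (dotC y x) (dotC y v); lra.
have Aux : A (- u) (- x).
  apply: maxA => y v Ayv; apply: le_trans (le_dot y v Ayv).
  by rewrite exprn_ge0.
exists x.
have /eqP : `|x + u| ^+ 2 = 0.
  apply/eqP; rewrite eq_le exprn_ge0// andbT.
  by have := le_dot _ _ Aux; rewrite !subrr dot0r.
by rewrite sqrf_eq0 normr_eq0 addr_eq0 => /eqP xu; rewrite -xu in Aux.
Qed.

End Minty.

(** This is [minty0] for the translate p |-> A p - x. *)
Lemma minty (A : X -> set X) : maximally_monotone dot A ->
  forall x, exists p, A p (x - p).
Proof.
move=> [monoA maxA] x.
have [|y u rel_yu|p] := @minty0 (fun p u => A p (u + x)).
- move=> y u z v Ayu Azv; have := monoA (y, u + x) (z, v + x) Ayu Azv.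
  by rewrite /= [v + x]addrC addrKA.
(* Adjoining the single pair (y, u + x) keeps the operator monotone, so by maximality the pair is
   already in the graph. *)
- pose B p w := A p w \/ (p = y /\ w = u + x).
  suff AB : gra B = gra A.
    by change (gra A (y, u + x)); rewrite -AB; right.
  apply: maxA; last by move=> p Ap; left.
  have rel z v : A z v -> 0 <= dot (y - z) (u + x - v).
    move=> Azv; have := rel_yu z (v - x); rewrite subrK => /(_ Azv).
    by rewrite opprB addrA.
  move=> [p w] [q v]; rewrite /gra /B /= => -[Apw|[-> ->]] [Aqv|[-> ->]].
  + exact: (monoA (_, _) (_, _) Apw Aqv).
  + by have := rel _ _ Apw; rewrite !dotE; lra.
  + exact: rel.
  + by rewrite !subrr dot0r.
- by rewrite addrC => Ap; exists p.
Qed.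

(** * Resolvents and reflected resolvents *)

Lemma resolvent_funP (A : X -> set X) : maximally_monotone dot A ->
  forall x, A (resolvent_fun A x) (x - resolvent_fun A x).
Proof.
move=> maxA x; have [p Ap] := minty A maxA x.
(* Minty's theorem makes this set nonempty, so [get] does not return its default. *)
have : resolvent A x (resolvent_fun A x).
  apply: (@getPex _ (resolvent A x)).
  by exists p, (x - p); rewrite // addrC subrK.
by move: (resolvent_fun A x) => q [u Aqu <-]; rewrite addrC addKr.
Qed.

(** With q the resolvent at p + u, monotonicity between (q, p + u - q) and (p, u) reads 0 <= -|q -
    p|^2. *)
Lemma resolvent_fun_gra (A : X -> set X) : maximally_monotone dot A ->
  forall p u, A p u -> resolvent_fun A (p + u) = p.
Proof.
move=> maxA p u Apu; set q := resolvent_fun A (p + u).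
have Aq : A q (p + u - q) := resolvent_funP A maxA (p + u).
have := maxA.1 (q, p + u - q) (p, u) Aq Apu.
have -> : (q, p + u - q).2 - (p, u).2 = - (q - p).
  by rewrite /= opprB addrAC addrK.
rewrite /= dotNr oppr_ge0 dot_hilbert => qp_le0.
apply/eqP; rewrite -subr_eq0 -normr_eq0 -sqrf_eq0 eq_le qp_le0.
by rewrite exprn_ge0.
Qed.

Lemma sub_reflected_resolvent (A : X -> set X) x y :
  (x - y) - (- reflected_resolvent A x - - reflected_resolvent A y) =
  2 *: (resolvent_fun A x - resolvent_fun A y).
Proof.
rewrite /reflected_resolvent.
set p := resolvent_fun A x; set q := resolvent_fun A y.
suff -> : - (2 *: p - x) - - (2 *: q - y) = x - y - 2 *: (p - q).
  by rewrite subKr.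
rewrite opprB opprK [2 *: q - y]addrC addrACA scalerBr opprB.
by rewrite [- _ + 2 *: q]addrC.
Qed.

Lemma norm_sub_reflected_resolvent (A : X -> set X) x y :
  let p := resolvent_fun A x in let q := resolvent_fun A y in
  `|x - y| ^+ 2
    - `|- reflected_resolvent A x - - reflected_resolvent A y| ^+ 2 =
  4 * dot (p - q) ((x - p) - (y - q)).
Proof.
(* With a = x - y and d = p - q, this is |a|^2 - |a - 2 d|^2 = 4 <d, a - d>. *)
move=> p q; rewrite -[- _ - - _](subKr (x - y)) sub_reflected_resolvent.
rewrite -/p -/q [in RHS]opprB [in RHS]addrACA.
rewrite -!dot_hilbert !dotE (dotC x p) (dotC x q) (dotC y p) (dotC y q).
by rewrite (dotC y x) (dotC q p); ring.
Qed.

(** * Strong nonexpansiveness and uniform monotonicity *)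

Lemma super_strongly_strongly (T : X -> X) :
  super_strongly_nonexpansive T -> strongly_nonexpansive T.
Proof.
move=> [neT ssT]; split=> // x y bounded_xy cvgT; apply: ssT.
have [M leM] := (@ex_bound _ _ _ _ _ (@globally_properfilter _ _ 0%N I)).1
  bounded_xy.
have leM' n : `|x n - y n| <= M by exact: leM.
(* If |b| <= |a| <= M, then 0 <= |a|^2 - |b|^2 <= 2 M (|a| - |b|). *)
have cvg2M : 2 * M * (`|x n - y n| - `|T (x n) - T (y n)|) @[n --> \oo]
    --> (0 : R).
  by rewrite -[X in _ --> X](mulr0 (2 * M)); apply: cvgM => //; exact: cvg_cst.
apply: (squeeze_cvgr _ (cvg_cst 0) cvg2M); apply: nearW => n.
have := neT (x n) (y n); have := leM' n.
have := normr_ge0 (x n - y n); have := normr_ge0 (T (x n) - T (y n)).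
by move=> *; apply/andP; split; nra.
Qed.

Lemma uniformly_monotone_super_strongly (A : X -> set X) :
  maximally_monotone dot A -> uniformly_monotone dot A ->
  super_strongly_nonexpansive (fun x => - reflected_resolvent A x).
Proof.
move=> maxA [phi [phi_ge0 phi_mono phi0] phi_le].
have JA := resolvent_funP A maxA.
split=> [x y|x y].
  rewrite -(ler_pXn2r (ltn0Sn 1)) ?nnegrE// -subr_ge0.
  rewrite norm_sub_reflected_resolvent mulr_ge0//.
  exact: (maxA.1 (_, _) (_, _) (JA x) (JA y)).
under eq_cvg do rewrite norm_sub_reflected_resolvent.
move=> cvg_dot; apply/cvgr0Pnorm_lt => e e_gt0.
have e2_gt0 : 0 < e / 2 by rewrite divr_gt0.
have phi_e : (0 < phi (e / 2)%R)%E.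
  rewrite lt_neqAle phi_ge0 ?ltW// andbT eq_sym; apply/eqP.
  by move=> /(phi0 _ (ltW e2_gt0)) e0; rewrite e0 ltxx in e2_gt0.
(* [phi] may be infinite at e / 2, so a finite positive [c] below it serves as threshold: |p - q| >=
   e / 2 would force <p - q, u - v> >= c. *)
have [c c_gt0 c_le] : exists2 c : R, 0 < c & (c%:E <= phi (e / 2)%R)%E.
  case: (phi (e / 2)) phi_e => [c|_|//]; first by rewrite lte_fin; exists c.
  by exists 1; rewrite // leey.
near=> n; rewrite sub_reflected_resolvent normrZ ger0_norm//.
rewrite mulrC -ltr_pdivlMr// ltNge; apply/negP => e_le.
have := phi_le (_, _) (_, _) (JA (x n)) (JA (y n)).
move=> /(le_trans (phi_mono _ _ (ltW e2_gt0) e_le)) /(le_trans c_le).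
rewrite lee_fin leNgt -(ltr_pM2l (@ltr0Sn R 3)) => /negP; apply.
by near: n; apply: (cvgr_lt 0 cvg_dot); rewrite mulr_gt0.
Unshelve. all: by end_near. Qed.

Lemma super_strongly_uniformly_monotone (A : X -> set X) :
  maximally_monotone dot A ->
  super_strongly_nonexpansive (fun x => - reflected_resolvent A x) ->
  uniformly_monotone dot A.
Proof.
move=> maxA [_ ssR].
(* Admitting all distances at least t makes the infimum nondecreasing; it is +oo if no such pair
   exists. *)
pose D t := [set e : \bar R | exists p q, [/\ gra A p, gra A q,
  t <= `|p.1 - q.1| & e = (dot (p.1 - q.1) (p.2 - q.2))%:E]].
have D_ge0 t : (0 <= ereal_inf (D t))%E.
  apply: le_ereal_inf_tmp => _ [p [q [Ap Aq _ ->]]].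
  by rewrite lee_fin; exact: maxA.1.
exists (fun t => ereal_inf (D t)); last first.
  by move=> p q Ap Aq; apply: ereal_inf_lbound; exists p, q.
split=> [t _ //|s t _ st|t t_ge0].
  apply: ereal_inf_le_tmp => _ [p [q [Ap Aq tpq ->]]].
  by exists p, q; split=> //; exact: le_trans tpq.
split=> [inf0|->]; last first.
  apply/eqP; rewrite eq_le D_ge0 andbT.
  (* A diagonal pair attains 0; the resolvent at 0 supplies a point of the graph. *)
  apply: ereal_inf_lbound; pose p := resolvent_fun A 0.
  have Ap : gra A (p, 0 - p) by exact: resolvent_funP.
  by exists (p, 0 - p), (p, 0 - p); split; rewrite //= !subrr ?normr0 ?dot0r.
apply/eqP; rewrite eq_le t_ge0 andbT leNgt; apply/negP => t_gt0.
have ex n : exists pq : (X * X) * (X * X), [/\ gra A pq.1, gra A pq.2,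
    t <= `|pq.1.1 - pq.2.1| &
    dot (pq.1.1 - pq.2.1) (pq.1.2 - pq.2.2) < harmonic n].
  have : (ereal_inf (D t) < (harmonic n)%:E)%E.
    by rewrite inf0 lte_fin harmonic_gt0.
  move=> /ereal_inf_lt[_ [p [q [Ap Aq tpq ->]]]]; rewrite lte_fin => lt_n.
  by exists (p, q).
have [z zP] := choice ex.
(* These sums have the chosen graph points as resolvents, so the hypothesis on sequences applies to
   the pairs of [z]. *)
pose x n := (z n).1.1 + (z n).1.2; pose y n := (z n).2.1 + (z n).2.2.
have Jx n : resolvent_fun A (x n) = (z n).1.1.
  by have [? _ _ _] := zP n; exact: resolvent_fun_gra.
have Jy n : resolvent_fun A (y n) = (z n).2.1.
  by have [_ ? _ _] := zP n; exact: resolvent_fun_gra.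
have cvg_dot : 4 * dot ((z n).1.1 - (z n).2.1) ((z n).1.2 - (z n).2.2)
    @[n --> \oo] --> (0 : R).
  have cvg4 : 4 * harmonic n @[n --> \oo] --> (0 : R).
    rewrite -[X in _ --> X](mulr0 4); apply: cvgM (@cvg_harmonic R).
    exact: cvg_cst.
  apply: (squeeze_cvgr _ (cvg_cst 0) cvg4); apply: nearW => n.
  have [Ap Aq _ /ltW lt_n] := zP n.
  by rewrite mulr_ge0 ?ler_pM2l//; exact: maxA.1.
have xB n : x n - (z n).1.1 = (z n).1.2 by rewrite addrC addKr.
have yB n : y n - (z n).2.1 = (z n).2.2 by rewrite addrC addKr.
have := ssR x y.
under eq_cvg do rewrite norm_sub_reflected_resolvent Jx Jy xB yB.
(* Tolerance t gives an N with 2 |p_N - q_N| < t, against t <= |p_N - q_N|. *)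
move=> /(_ cvg_dot) /cvgr0Pnorm_lt /(_ t t_gt0) [N _ /(_ N (leqnn N))] /=.
have [_ _ t_le _] := zP N.
rewrite sub_reflected_resolvent Jx Jy normrZ ger0_norm// => lt_t.
by have := normr_ge0 ((z N).1.1 - (z N).2.1); lra.
Qed.

End HilbertForm.

Theorem proposition3p5 (R : realType) (X : completeNormedModType R)
    (dot : {dot X for (@idfun R)}) (dot_hilbert : hilbert_form dot)
    (A : X -> set X) (A_max : maximally_monotone dot A) :
  (uniformly_monotone dot A <->
     super_strongly_nonexpansive (fun x => - reflected_resolvent A x)) /\
  (super_strongly_nonexpansive (fun x => - reflected_resolvent A x) ->
     strongly_nonexpansive (fun x => - reflected_resolvent A x)).
Proof.
split; last exact: super_strongly_strongly.
split; first exact: uniformly_monotone_super_strongly.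
exact: super_strongly_uniformly_monotone.
Qed.
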